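(* Let $P\in\mathbb{Z}[X]$ be a separable polynomial of degree $2$. Then for all $N\ge2$, $$M_2(N;P)\ll_P\sqrt{N},$$ where $$M_2(N;P):=\#\left\{(m,n_1,n_2)\in\mathbb{N}^3: 1\le n_1,n_2\le N,\ P(n_1)P(n_2)=m^2\ne0,\ n_1\ne n_2\right\}.$$
   Context: A polynomial is separable if it has no repeated roots in $\mathbb{C}$. The notation $X\ll_P Y$ means $|X|\le C\,Y$ for a constant $C>0$ depending only on $P$. *)

(* Defs.v *)
From mathcomp Require Import all_boot all_order all_algebra finmap.
From mathcomp Require Import boolp classical_sets functions cardinality reals.
From mathcomp Require Import complex.

Set Implicit Arguments.
Unset Strict Implicit.
Unset Printing Implicit Defensive.

Import Order.TTheory GRing.Theory Num.Theory.

Local Open Scope classical_set_scope.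
Local Open Scope ring_scope.

(* With R : realType, R[i] is the field of complex numbers; z is a repeated
   root of P exactly when ('X - z)^2 divides P there. *)
Definition separable_over_C (R : realType) (P : {poly int}) : Prop :=
  forall z : R[i],
    ~~ (('X - z%:P) ^+ 2 %| map_poly (intr : int -> R[i]) P)%R.

(* Triples (m, n1, n2), encoded as ((m, n1), n2). *)
Definition square_triples (N : nat) (P : {poly int}) : set (nat * nat * nat) :=
  [set t | let: (m, n1, n2) := t in
    [/\ (1 <= n1 <= N)%N, (1 <= n2 <= N)%N,
        P.[n1%:Z] * P.[n2%:Z] = m%:Z ^+ 2, m%:Z ^+ 2 != 0 & n1 <> n2]].

Definition M2 (N : nat) (P : {poly int}) : nat := #|` fset_set (square_triples N P)|.

(* fset_set returns the empty set on infinite sets, so M2 is the intended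
   cardinality only because of the following fact. *)
Lemma finite_square_triples (N : nat) (P : {poly int}) :
  finite_set (square_triples N P).
Proof.
pose B := (\sum_(i < N.+1) \sum_(j < N.+1) absz (P.[i%:Z] * P.[j%:Z])%R)%N.
apply: (@sub_finite_set _ _ (`I_B.+1 `*` `I_N.+1 `*` `I_N.+1)); last first.
  by do 2?[apply: finite_setX]; exact: finite_II.
move=> [[m n1] n2] /= [/andP[_ n1N] /andP[_ n2N] e m0 _].
split; [split=> /= |] => //; rewrite ltnS.
apply: (@leq_trans (absz (P.[n1%:Z] * P.[n2%:Z]))).
  by rewrite e abszX /=; case: m {e m0} => // m; rewrite expnS expn1 leq_pmulr.
rewrite /B (bigD1 (Ordinal (n1N : n1 < N.+1)%N)) //=.
rewrite (bigD1 (Ordinal (n2N : n2 < N.+1)%N)) //=.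
by rewrite -addnA leq_addr.
Qed.

(* Main.v *)
(** Write D for the discriminant of P = a X^2 + b X + c and y = |2 a n + b|, so that
    4 a P(n) = y^2 - D; having a product that is a nonzero square is an equivalence
    relation on the values y^2 - D.  If y1 < y2 are equivalent, with
    (y1^2 - D)(y2^2 - D) = M^2, put w = y1 y2 - M.  Then
    (w^2 - D^2)(y1^2 - D) is a nonzero square, so |w| determines the equivalence
    class, while |w| is O(y2 / y1); moreover y1 and w leave at most two values
    of y2.

    Let H be about N^(1/2) and r about N^(1/6).  Cutting the range of y into six
    intervals of ratio r, every class has O(r) elements.  The classes containing
    two elements of ratio at most r are determined by some |w| = O(r), hence
    contribute O(r * r^2) = O(H) pairs.  Every other class has at most six
    elements, and a pair in it has either y1 <= H or y2 / y1 = O(H), hence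
    |w| = O(H): so there are O(H) such classes that contain a pair. *)

Require Import Defs.
From mathcomp Require Import all_boot all_order all_algebra.
From mathcomp Require Import reals.
From mathcomp Require Import finmap boolp classical_sets cardinality complex.
From mathcomp Require Import zify ring.

Import Order.TTheory GRing.Theory Num.Theory.

Local Open Scope ring_scope.

(** * The square-product relation and the witness w *)

(** Without the nonvanishing condition 0 would be related to everything and transitivity would
    fail. *)
Definition sqrel (a b : int) : Prop := a * b != 0 /\ exists m : int, a * b = m ^+ 2.

Lemma sqrelC a b : sqrel a b -> sqrel b a.
Proof. by rewrite /sqrel mulrC. Qed.

(** From ab = m^2 and bc = k^2 one gets ac b^2 = (mk)^2, so b divides mk and the quotient is the
    required root. *)
Lemma sqrel_trans b a c : sqrel a b -> sqrel b c -> sqrel a c.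
Proof.
move=> [ab0 [m abE]] [bc0 [k bcE]].
move: ab0 bc0; rewrite !mulf_eq0 !negb_or => /andP[a0 b0] /andP[_ c0].
split; first by rewrite mulf_neq0.
have acE : a * c * b ^+ 2 = (m * k) ^+ 2.
  by rewrite exprMn -abE -bcE; ring.
have /dvdzP[q qE] : (b %| m * k)%Z.
  by rewrite dvdzE -(@dvdn_pexp2r _ _ 2) // -!abszX -acE abszM abszX dvdn_mull.
exists q; apply: (@mulIf _ (b ^+ 2)); first by rewrite expf_neq0.
by rewrite acE qE exprMn.
Qed.

(** Take w = y1 y2 - |m|. Then w (y1 y2 + |m|) = D (y1^2 + y2^2 - D), and for y1 <= y2 the last
    factor has absolute value at most 3 y2^2 because |D| < y1. *)
Lemma sqrel_witness (D : int) (y1 y2 : nat) :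
    (`|D| < y1)%N -> (`|D| < y2)%N ->
    sqrel (y1%:Z ^+ 2 - D) (y2%:Z ^+ 2 - D) ->
  exists w : int,
    (`|w| * minn y1 y2 <= 3 * `|D| * maxn y1 y2)%N /\
    (y1%:Z * y2%:Z - w) ^+ 2 = (y1%:Z ^+ 2 - D) * (y2%:Z ^+ 2 - D).
Proof.
wlog le12 : y1 y2 / (y1 <= y2)%N => [wl|] Dy1 Dy2 r12.
  case/orP: (leq_total y1 y2) => [le12|le21]; first exact: wl.
  have [w [? wE]] := wl y2 y1 le21 Dy2 Dy1 (sqrelC _ _ r12).
  by exists w; rewrite minnC maxnC (mulrC _ y2%:Z) [RHS]mulrC.
rewrite (minn_idPl le12) (maxn_idPr le12).
case: r12 => _ [m mE]; exists (y1%:Z * y2%:Z - `|m|); split; last first.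
  by rewrite subKr mE real_normK ?num_real.
set w := _ - _.
have wE : w * (y1%:Z * y2%:Z + `|m|) = D * (y1%:Z ^+ 2 + y2%:Z ^+ 2 - D).
  by rewrite /w -subr_sqr real_normK ?num_real // -mE; ring.
have {}wE : (`|w| * (y1 * y2 + `|m|) = `|D| * absz (y1%:Z ^+ 2 + y2%:Z ^+ 2 - D)%R)%N.
  by rewrite -abszM -wE abszM; congr (_ * _)%N; lia.
rewrite -(leq_pmul2r (_ : 0 < y2)%N); last by lia.
have tle : (absz (y1%:Z ^+ 2 + y2%:Z ^+ 2 - D)%R <= 3 * (y2 * y2))%N.
  have [y11 y12] : (y1 * 1 <= y1 * y1 /\ y1 * y1 <= y2 * y2)%N.
    by split; apply: leq_mul; lia.
  by rewrite !expr2 -!PoszM; lia.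
apply: (@leq_trans (`|w| * (y1 * y2 + `|m|))).
  by rewrite -mulnA leq_mul2l leq_addr orbT.
by rewrite wE (mulnC 3%N) -!mulnA leq_mul2l tle orbT.
Qed.

Lemma shifted_square_neq0 (D : int) (y : nat) :
  (`|D| < y)%N -> y%:Z ^+ 2 - D != 0.
Proof.
move=> Dy; apply/eqP => /eqP; rewrite subr_eq0 expr2 -PoszM => /eqP yD.
have : (y * 1 <= y * y)%N by apply: leq_mul; lia.
by lia.
Qed.

(** With M = y1 y2 - w, the product is the square of y1 M - y2 (y1^2 - D). Were that zero, squaring
    would give D (y1^2 - D) (y1^2 - y2^2) = 0. *)
Lemma witness_sqrel (D : int) (y1 y2 : nat) (w : int) :
    (`|D| < y1)%N -> D != 0 -> y1 <> y2 ->
    (y1%:Z * y2%:Z - w) ^+ 2 = (y1%:Z ^+ 2 - D) * (y2%:Z ^+ 2 - D) ->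
  sqrel (`|w|%:Z ^+ 2 - D ^+ 2) (y1%:Z ^+ 2 - D).
Proof.
move=> Dy1 D0 y12 wE.
have sqE : (`|w|%:Z ^+ 2 - D ^+ 2) * (y1%:Z ^+ 2 - D) =
    (y1%:Z * (y1%:Z * y2%:Z - w) - y2%:Z * (y1%:Z ^+ 2 - D)) ^+ 2.
  have -> : `|w|%:Z ^+ 2 = w ^+ 2 by rewrite abszE real_normK ?num_real.
  apply/eqP; rewrite -subr_eq0; apply/eqP.
  transitivity (D * ((y1%:Z ^+ 2 - D) * (y2%:Z ^+ 2 - D)
    - (y1%:Z * y2%:Z - w) ^+ 2)); first by ring.
  by rewrite wE subrr mulr0.
split; last by eexists; exact: sqE.
rewrite sqE sqrf_eq0 subr_eq0; apply/eqP => /(congr1 (fun z => z ^+ 2)).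
rewrite !exprMn wE => yE.
have: D * (y1%:Z ^+ 2 - D) * (y1%:Z ^+ 2 - y2%:Z ^+ 2) = 0.
  by move/eqP: yE; rewrite -subr_eq0 => /eqP yE; rewrite -oppr0 -yE; ring.
move/eqP; rewrite !mulf_eq0 (negPf D0) (negPf (shifted_square_neq0 _ _ Dy1)).
by rewrite subr_eq0 eqrXn2 // => /eqP[].
Qed.

(* y1 and y2 are roots of D Y^2 - 2 w y0 Y + (w^2 + D y0^2 - D^2); the last
   hypothesis puts them on the same side of its vertex. *)
Lemma witness_inj (D : int) (y0 y1 y2 : nat) (w : int) :
    D != 0 ->
    (y0%:Z * y1%:Z - w) ^+ 2 = (y0%:Z ^+ 2 - D) * (y1%:Z ^+ 2 - D) ->
    (y0%:Z * y2%:Z - w) ^+ 2 = (y0%:Z ^+ 2 - D) * (y2%:Z ^+ 2 - D) ->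
    (w * y0%:Z <= D * y1%:Z) = (w * y0%:Z <= D * y2%:Z) ->
  y1 = y2.
Proof.
move=> D0 e1 e2 side.
have : (D * y1%:Z - w * y0%:Z) ^+ 2 = (D * y2%:Z - w * y0%:Z) ^+ 2.
  apply/eqP; rewrite -subr_eq0; apply/eqP.
  transitivity (D * (((y0%:Z ^+ 2 - D) * (y2%:Z ^+ 2 - D) - (y0%:Z * y2%:Z - w) ^+ 2)
    - ((y0%:Z ^+ 2 - D) * (y1%:Z ^+ 2 - D) - (y0%:Z * y1%:Z - w) ^+ 2))); first by ring.
  by rewrite e1 e2 !subrr mulr0.
move/eqP; rewrite eqf_sqr => /orP[] /eqP h.
  have : D * y1%:Z = D * y2%:Z by lia.
  by move/(mulfI D0) => [].
have : D * y1%:Z = D * y2%:Z by lia.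
by move/(mulfI D0) => [].
Qed.

(** * Counting related pairs class by class *)

(** A union bound. Bounding all subsets [F] on which [Q j] holds lets the [Q j] be overlapping,
    undecided propositions. *)
Lemma card_cover (T : finType) (E : {set T}) (Q : nat -> T -> Prop) (k m : nat) :
    (forall z, z \in E -> exists2 j, (j < k)%N & Q j z) ->
    (forall j (F : {set T}), F \subset E -> (forall z, z \in F -> Q j z) ->
      (#|F| <= m)%N) ->
  (#|E| <= k * m)%N.
Proof.
move=> cov bnd.
have -> : E = (\bigcup_(j < k) [set z in E | `[< Q j z >]])%SET.
  apply/setP => z; apply/idP/bigcupP => [zE|[j _]]; last by rewrite inE => /andP[].
  have [j jk jz] := cov z zE.
  by exists (Ordinal jk) => //; rewrite inE zE; apply/asboolP.
set G := BIG_F; apply: (@leq_trans (\sum_(j < k) #|G j|)).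
  elim/big_rec2: _ => [|j n A _ leA]; first by rewrite cards0.
  by rewrite (leq_trans (leq_card_setU _ _)) // leq_add2l.
rewrite -[k in (k * m)%N]card_ord -sum_nat_const; apply: leq_sum => j _.
apply: (bnd j); first by apply/fintype.subsetP => z; rewrite inE => /andP[].
by move=> z; rewrite inE => /andP[_ /asboolP].
Qed.

(* S0 holds the finitely many small n, for which y may fail to be injective or
   y^2 - D to be positive. *)
Section PairCount.
Variables (T : finType) (y : T -> nat) (D : int) (S0 : {set T}).
Variables (B R H n0 : nat).
Hypotheses (D0 : D != 0) (D_lt_B : (`|D| < B)%N) (R_gt0 : (0 < R)%N).
Hypothesis R3_le_H : (R ^ 3 <= H)%N.
Hypothesis card_S0 : (#|S0| <= n0)%N.
Hypothesis y_inj : {in ~: S0 &, injective y}.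
Hypothesis y_ge : forall z, z \notin S0 -> (B <= y z)%N.
Hypothesis y_lt : forall z, z \notin S0 -> (y z < B * R ^ 6)%N.
Hypothesis y_le : forall z, z \notin S0 -> (y z <= B * H ^ 2)%N.

Local Notation A z := ((y z)%:Z ^+ 2 - D).

Let related x z := [&& x \notin S0, z \notin S0 & `[< sqrel (A x) (A z) >]].
Let cls x := [set z | related x z]%SET.
(** [V] counts the possible |w| within one level; [K] multiplies this by six levels and by two
    binary choices. *)
Let V := (3 * `|D| * R).+1.
Let K := (6 * (V * 4))%N.

Let relatedP x z :
  related x z -> [/\ x \notin S0, z \notin S0 & sqrel (A x) (A z)].
Proof. by case/and3P => ? ? /asboolP. Qed.

Let related_sym x z : related x z -> related z x.
Proof. by move=> /relatedP[x0 z0 r]; rewrite /related z0 x0; apply/asboolP/sqrelC. Qed.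

Let related_trans z x t : related x z -> related z t -> related x t.
Proof.
move=> /relatedP[x0 _ r] /relatedP[_ t0 s].
by rewrite /related x0 t0; apply/asboolP/(sqrel_trans _ _ _ r s).
Qed.

Let related_witness x z : related x z ->
  exists w : int, (`|w| * minn (y x) (y z) <= 3 * `|D| * maxn (y x) (y z))%N /\
    ((y x)%:Z * (y z)%:Z - w) ^+ 2 = A x * A z.
Proof.
move=> /relatedP[x0 z0 r].
by apply: sqrel_witness r; apply: (leq_trans D_lt_B); exact: y_ge.
Qed.

Let level j z := (B * R ^ j <= y z < B * R ^ j.+1)%N.

Let level_cover z : z \notin S0 -> exists2 j, (j < 6)%N & level j z.
Proof.
move=> z0; have := y_lt z z0; elim: 6%N => [|k IH] yz.
  by move: yz; rewrite expn0 muln1 ltnNge y_ge.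
have [/IH[j jk jz]|yz'] := ltnP (y z) (B * R ^ k).
  by exists j => //; rewrite ltnS ltnW.
by exists k => //; rewrite /level yz' yz.
Qed.

Let level_ratio j x z : level j x -> level j z -> (y z < R * y x)%N.
Proof.
move=> /andP[lx _] /andP[_ zl]; apply: (leq_trans zl).
by rewrite expnS mulnCA leq_mul2l lx orbT.
Qed.

(** Within a level the ratio is below [R], so |w| < [V]. With [x] fixed, [witness_inj] recovers [z]
    from w and the side of the vertex. *)
Let card_level j x (F : {set T}) : level j x ->
    (forall z, z \in F -> related x z /\ level j z) ->
  (#|F| <= V * 4)%N.
Proof.
move=> jx FP.
have [w wP] : {w : T -> int & forall z, z \in F -> (`|w z| < V)%N /\
    ((y x)%:Z * (y z)%:Z - w z) ^+ 2 = A x * A z}.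
  apply: (@boolp.choice _ _ (fun z (w : int) => z \in F -> (`|w| < V)%N /\
    ((y x)%:Z * (y z)%:Z - w) ^+ 2 = A x * A z)) => z.
  have [zF|_] := boolP (z \in F); last by exists 0.
  have [/[dup] xz /relatedP[x0 z0 _] jz] := FP z zF.
  have [w [w_le wE]] := related_witness _ _ xz.
  exists w => _; split => //; rewrite /V ltnS.
  have xz_le := level_ratio _ _ _ jx jz; have zx_le := level_ratio _ _ _ jz jx.
  have min_gt0 : (0 < minn (y x) (y z))%N.
    by rewrite leq_min; move: (y_ge x x0) (y_ge z z0); lia.
  rewrite -(leq_pmul2r min_gt0); apply: (leq_trans w_le).
  rewrite -(mulnA _ R) leq_mul2l; apply/orP; right.
  have [_|_] := leqP (y x) (y z); exact: ltnW.
(* The integer w is stored as its absolute value and its sign; the last bit is the side of the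
   vertex. *)
pose key z := (inord (`|w z|)%N : 'I_V, 0 <= w z, w z * (y x)%:Z <= D * (y z)%:Z).
have key_inj : {in F &, injective key}.
  move=> z t zF tF [/(congr1 val) /= e1 e2 e3].
  have [zV zE] := wP z zF; have [tV tE] := wP t tF.
  rewrite !inordK // in e1.
  have wE : w z = w t by lia.
  have [/relatedP[_ z0 _] _] := FP z zF; have [/relatedP[_ t0 _] _] := FP t tF.
  apply: y_inj; rewrite ?inE //; rewrite wE in zE e3.
  exact: witness_inj D0 zE tE e3.
rewrite -(card_in_imset key_inj); apply: (leq_trans (max_card _)).
by rewrite !card_prod card_ord card_bool -mulnA.
Qed.

Let card_cls x : (#|cls x| <= K)%N.
Proof.
apply: (card_cover _ _ level).
  by move=> z; rewrite inE => /relatedP[_ z0 _]; exact: level_cover.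
move=> j F /fintype.subsetP Fx Fj.
have [->|[z zF]] := set_0Vmem F; first by rewrite cards0.
apply: (card_level j z); first exact: Fj.
move=> t tF; split; last exact: Fj.
have := Fx z zF; have := Fx t tF; rewrite !inE => xt xz.
exact: related_trans (related_sym _ _ xz) xt.
Qed.

Let dense x := exists z t, [/\ related x z, related x t, (y z < y t)%N &
  (y t <= R * y z)%N].

(** Two elements of one level have ratio below [R], so a sparse class has at most one element in
    each of the six levels. *)
Let card_sparse_cls x : ~ dense x -> (#|cls x| <= 6)%N.
Proof.
move=> sparse; rewrite -[6%N]muln1; apply: (card_cover _ _ level).
  by move=> z; rewrite inE => /relatedP[_ z0 _]; exact: level_cover.
move=> j F /fintype.subsetP Fx Fj; apply/card_le1_eqP => z t zF tF.
have := Fx z zF; have := Fx t tF; rewrite !inE => xt xz.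
have zt := level_ratio _ _ _ (Fj z zF) (Fj t tF).
have tz := level_ratio _ _ _ (Fj t tF) (Fj z zF).
have [_ z0 _] := relatedP _ _ xz; have [_ t0 _] := relatedP _ _ xt.
apply: y_inj; rewrite ?inE //.
have [lt|lt|//] := ltngtP (y t) (y z); case: sparse.
  by exists t, z; split => //; exact: ltnW.
by exists z, t; split => //; exact: ltnW.
Qed.

(** A label v < [W] singles out one class, and both entries of a pair with that label lie in it. *)
Let card_pairs (S : {set T * T}) (Q : nat -> T -> Prop) (W k : nat) :
    (forall p, p \in S -> related p.1 p.2 /\ exists2 v, (v < W)%N & Q v p.1) ->
    (forall v x z, Q v x -> Q v z -> related x z) ->
    (forall p, p \in S -> (#|cls p.1| <= k)%N) ->
  (#|S| <= W * (k * k))%N.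
Proof.
move=> SP Qrel clsk; apply: (card_cover _ _ (fun v p => Q v p.1)).
  by move=> p /SP[].
move=> v F /fintype.subsetP FS FQ.
have [->|[p pF]] := set_0Vmem F; first by rewrite cards0.
apply: (@leq_trans #|finset.setX (cls p.1) (cls p.1)|); last first.
  by rewrite cardsX leq_mul // clsk // FS.
apply/subset_leq_card/fintype.subsetP => -[a b] abF; rewrite finset.in_setX !inE /=.
have pa : related p.1 a := Qrel _ _ _ (FQ p pF) (FQ (a, b) abF).
by rewrite pa (related_trans _ _ _ pa) //; case: (SP (a, b) (FS _ abF)).
Qed.

(** The label v is |w|, which fixes the class through v^2 - D^2. *)
Let Qw (v : nat) x := x \notin S0 /\ sqrel (v%:Z ^+ 2 - D ^+ 2) (A x).

Let Qw_related v x z : Qw v x -> Qw v z -> related x z.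
Proof.
move=> [x0 vx] [z0 vz]; rewrite /related x0 z0; apply/asboolP.
exact: sqrel_trans (sqrelC _ _ vx) vz.
Qed.

(** Applied with [c = R] in dense classes and [c = B * H] in sparse ones. *)
Let Qw_exists x z (c : nat) :
    related x z -> (y x < y z)%N -> (y z <= c * y x)%N ->
  exists2 v, (v < (3 * `|D| * c).+1)%N & Qw v x.
Proof.
move=> /[dup] xz /relatedP[x0 z0 _] ltxz zx.
have [w [w_le wE]] := related_witness _ _ xz.
have Dx : (`|D| < y x)%N by apply: (leq_trans D_lt_B); exact: y_ge.
exists `|w|%N; last first.
  by split=> //; apply: witness_sqrel wE => //; move=> e; rewrite e ltnn in ltxz.
rewrite (minn_idPl (ltnW ltxz)) (maxn_idPr (ltnW ltxz)) in w_le.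
rewrite ltnS -(leq_pmul2r (_ : 0 < y x)%N) ?(leq_ltn_trans _ Dx) //.
by apply: (leq_trans w_le); rewrite -(mulnA _ c) leq_mul2l zx orbT.
Qed.

(** A class is labelled here by the value of [y] at any member; injectivity of [y] off [S0] makes
    the label determine the class. *)
Let Qy (v : nat) x := exists2 z, related x z & y z = v.

Let Qy_related v x z : Qy v x -> Qy v z -> related x z.
Proof.
move=> [x' xx' yx'] [z' zz' yz'].
have [_ x0 _] := relatedP _ _ xx'; have [_ z0 _] := relatedP _ _ zz'.
have e : x' = z' by apply: y_inj; rewrite ?inE // yx'.
by apply: (related_trans _ _ _ xx'); rewrite e; exact: related_sym.
Qed.

(** For a fixed first entry in [S0], the second entries outside [S0] are all related to one another,
    so they lie in a single class. *)
Let card_fixed_fst (S : {set T * T}) :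
    (forall p, p \in S -> p.1 \in S0 /\ sqrel (A p.1) (A p.2)) ->
  (#|S| <= n0 * (n0 + K))%N.
Proof.
move=> SP; rewrite -sum1_card (partition_big fst (mem S0)); last by move=> p /SP[].
apply: (@leq_trans (\sum_(x in S0) (n0 + K))); last first.
  by rewrite sum_nat_const leq_mul2r card_S0 orbT.
apply: leq_sum => x xS; rewrite sum1_card -cardsE.
set F := finset _.
have FP p : p \in F -> p \in S /\ p.1 = x.
  by rewrite inE => /andP[? /eqP].
have snd_inj : {in F &, injective snd}.
  by move=> [a b] [c d] /FP[_ /= ->] /FP[_ /= ->] /= ->.
rewrite -(card_in_imset snd_inj).
set G := imset _ _; rewrite -(cardsID S0) leq_add //.
  by apply: leq_trans card_S0; rewrite subset_leq_card // subsetIr.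
have [->|[z]] := set_0Vmem (G :\: S0)%SET; first by rewrite cards0.
have GP t : t \in (G :\: S0)%SET -> t \notin S0 /\ sqrel (A x) (A t).
  rewrite inE => /andP[t0 /imsetP[p /FP[pS px] tE]].
  by split=> //; rewrite tE -px; case: (SP p pS).
move=> /GP[z0 xz]; apply: leq_trans (card_cls z).
apply/subset_leq_card/fintype.subsetP => t /GP[t0 xt].
rewrite inE /related z0 t0; apply/asboolP.
exact: sqrel_trans (sqrelC _ _ xz) xt.
Qed.

(** [S1] and [S2] have an entry in [S0] and are O(R); the dense pairs [S3] are O(R^3); the sparse
    pairs, with some y <= [H] in [S4] and none in [S5], are O(H). *)
Lemma card_sqrel_pairs (k := (24 * (3 * `|D|).+1)%N) :
  (#|[set p : T * T | (p.1 != p.2) && `[< sqrel (A p.1) (A p.2) >]]%SET| <=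
   (2 * (n0 * (n0 + k)) + (3 * `|D|).+1 * (k * k) + 72
    + 36 * (3 * `|D| * B).+1) * H)%N.
Proof.
set S := finset _.
have SP p : p \in S -> p.1 <> p.2 /\ sqrel (A p.1) (A p.2).
  by rewrite inE => /andP[/eqP ? /asboolP].
clearbody S.
pose S1 := [set p in S | p.1 \in S0]%SET.
pose S2 := [set p in S | p.2 \in S0]%SET.
pose S3 := [set p in S | related p.1 p.2 && `[< dense p.1 >]]%SET.
pose S4 := [set p in S | [&& related p.1 p.2, ~~ `[< dense p.1 >] &
  (y p.1 <= H) || (y p.2 <= H)]%N]%SET.
pose S5 := [set p in S | [&& related p.1 p.2, ~~ `[< dense p.1 >],
  (H < y p.1) & (H < y p.2)]%N]%SET.
have S1_le : (#|S1| <= n0 * (n0 + K))%N.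
  by apply: card_fixed_fst => p; rewrite inE => /andP[/SP[_ ?] ?].
have S2_le : (#|S2| <= n0 * (n0 + K))%N.
  pose sw (p : T * T) := (p.2, p.1).
  have sw_inj : injective sw by move=> [a b] [c d] [-> ->].
  rewrite -(card_imset _ sw_inj); apply: card_fixed_fst => p /imsetP[q].
  by rewrite inE => /andP[/SP[_ /sqrelC ?] ?] ->.
have S3_le : (#|S3| <= V * (K * K))%N.
  apply: (card_pairs _ Qw) => [p|v x z|p _]; [|exact: Qw_related|exact: card_cls].
  rewrite inE => /and3P[_ p12 /asboolP[z [t [pz pt ltzt zt]]]]; split=> //.
  (* The close elements [z], [t] need not be the entries of [p]; their label passes to [p.1] because
     they share its class. *)
  have zt_rel := related_trans _ _ _ (related_sym _ _ pz) pt.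
  have [v vV [z0 vz]] := Qw_exists _ _ _ zt_rel ltzt zt.
  exists v => //; split; first by case/relatedP: pz.
  by apply: sqrel_trans vz _; case/relatedP: (related_sym _ _ pz).
have S4_le : (#|S4| <= H.+1 * (6 * 6))%N.
  apply: (card_pairs _ Qy) => [p|v x z|p]; [|exact: Qy_related|].
    rewrite inE => /and4P[_ p12 _ /orP[] yH]; split=> //.
      exists (y p.1); rewrite ?ltnS //; exists p.1 => //.
      exact: related_trans p12 (related_sym _ _ p12).
    by exists (y p.2); rewrite ?ltnS //; exists p.2.
  by rewrite inE => /and4P[_ _ /asboolPn p_sparse _]; exact: card_sparse_cls.
have S5_le : (#|S5| <= (3 * `|D| * (B * H)).+1 * (6 * 6))%N.
  (* Since y z <= B H^2 and y x > H, the ratio is at most B H. *)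
  have BH x z : (H < y x)%N -> z \notin S0 -> (y z <= B * H * y x)%N.
    move=> Hx z0; apply: (leq_trans (y_le z z0)).
    by rewrite expnS expn1 mulnA leq_mul2l (ltnW Hx) orbT.
  apply: (card_pairs _ Qw) => [p|v x z|p]; [|exact: Qw_related|].
    rewrite inE => /and5P[/SP[p_neq _] p12 _ H1 H2]; split=> //.
    have [p1 p2 r12] := relatedP _ _ p12.
    have [lt|lt|e] := ltngtP (y p.1) (y p.2).
    - by apply: (Qw_exists _ p.2) => //; exact: BH.
    - have [v vV [_ v2]] := Qw_exists _ _ _ (related_sym _ _ p12) lt (BH _ _ H2 p1).
      by exists v => //; split=> //; apply: sqrel_trans v2 (sqrelC _ _ r12).
    - by case: p_neq; apply: y_inj; rewrite ?inE.
  by rewrite inE => /and5P[_ _ /asboolPn p_sparse _ _]; exact: card_sparse_cls.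
have S_le : (#|S| <= #|S1| + #|S2| + #|S3| + #|S4| + #|S5|)%N.
  apply: (@leq_trans #|S1 :|: S2 :|: S3 :|: S4 :|: S5|%SET).
    apply/subset_leq_card/fintype.subsetP => p pS; rewrite !inE pS /=.
    have [//|p1] := boolP (p.1 \in S0); have [//|p2] := boolP (p.2 \in S0).
    have -> : related p.1 p.2.
      by rewrite /related p1 p2; apply/asboolP; case: (SP p pS).
    by case: asboolP => //= _; rewrite !ltnNge -negb_or orbN.
  do 4![apply: (leq_trans (leq_card_setU _ _)); rewrite leq_add2r].
  exact: leqnn.
have R_le : (R <= H)%N by apply: leq_trans R3_le_H; rewrite expnS leq_pmulr ?expn_gt0 ?R_gt0.
have VR : (V <= (3 * `|D|).+1 * R)%N by rewrite /V mulSn -add1n leq_add2r.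
have KR : (K <= k * R)%N by rewrite /K /k mulnC -!mulnA; lia.
have S12 : (n0 * (n0 + K) <= n0 * (n0 + k) * H)%N.
  rewrite -mulnA leq_mul2l mulnDl leq_add ?orbT //.
    by rewrite leq_pmulr // (leq_trans R_gt0 R_le).
  by rewrite (leq_trans KR) // leq_mul2l R_le orbT.
have S33 : (V * (K * K) <= (3 * `|D|).+1 * (k * k) * H)%N.
  apply: (@leq_trans (((3 * `|D|).+1 * R) * ((k * R) * (k * R)))).
    by apply: leq_mul => //; exact: leq_mul.
  have -> : (((3 * `|D|).+1 * R) * ((k * R) * (k * R)) =
    ((3 * `|D|).+1 * (k * k)) * R ^ 3)%N by rewrite !expnS expn0; ring.
  by rewrite leq_mul2l R3_le_H orbT.
have S45 : (H.+1 * (6 * 6) + (3 * `|D| * (B * H)).+1 * (6 * 6) <=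
    (72 + 36 * (3 * `|D| * B).+1) * H)%N.
  have H_gt0 : (0 < H)%N := leq_trans R_gt0 R_le.
  rewrite (mulnA _ B); move: (3 * `|D| * B)%N => t; nia.
lia.
Qed.
End PairCount.

(** * Integer roots, discriminants and the map n to |2 a n + b| *)

Lemma nat_root_exists (k n : nat) : (0 < k)%N -> (0 < n)%N ->
  exists h, [/\ (0 < h)%N, (h ^ k <= n)%N & (n < h.+1 ^ k)%N].
Proof.
move=> k0 n0.
have ex : exists h, (h ^ k <= n)%N by exists 1%N; rewrite exp1n.
have ub h : (h ^ k <= n)%N -> (h <= n)%N.
  case: h => // h; apply: leq_trans; rewrite -[X in (X <= _)%N]expn1.
  by rewrite leq_pexp2l.
case: (ex_maxnP ex ub) => h hk hmax; exists h; split=> //.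
  by apply: hmax; rewrite exp1n.
by rewrite ltnNge; apply/negP => /hmax; rewrite ltnn.
Qed.

Lemma quadratic_polyE (R : nzRingType) (p : {poly R}) : (size p <= 3)%N ->
  p = p`_2 *: 'X^2 + p`_1 *: 'X + (p`_0)%:P.
Proof.
move=> sp; apply/polyP => -[|[|[|i]]]; rewrite !coefE /= ?mulr0 ?mulr1 ?add0r ?addr0 //.
by rewrite nth_default ?addr0 // (leq_trans sp).
Qed.

(** Completing the square gives a (X - z)^2 with z = -b / (2a). *)
Lemma quadratic_disc0_sqr_dvd (F : numFieldType) (a b c : F) :
    a != 0 -> b ^+ 2 = 4 * a * c ->
  exists z, ('X - z%:P) ^+ 2 %| a *: 'X^2 + b *: 'X + c%:P.
Proof.
move=> a0 disc0; pose z := - b / (2 * a); exists z.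
have bE : b = - 2 * a * z by rewrite /z; field.
have cE : c = a * z ^+ 2.
  have a4 : 4 * a != 0 by rewrite mulf_neq0 ?pnatr_eq0.
  by apply: (mulfI a4); rewrite -disc0 /z; field.
have -> : a *: 'X^2 + b *: 'X + c%:P = a *: ('X - z%:P) ^+ 2.
  rewrite cE bE -!mul_polyC !(polyCM, polyCN, polyC_exp, polyC_natr).
  by ring.
by rewrite dvdpZr.
Qed.

Lemma quadratic_disc_neq0 (R : realType) (P : {poly int}) :
  size P = 3%N -> separable_over_C R P -> P`_1 ^+ 2 - 4 * P`_2 * P`_0 != 0.
Proof.
move=> sP sepP; apply/eqP => /eqP; rewrite subr_eq0 => /eqP.
move=> /(congr1 (fun x : int => x%:~R : R[i])); rewrite rmorphXn !rmorphM /=.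
have a0 : (P`_2)%:~R != 0 :> R[i].
  rewrite intr_eq0; have := lead_coef_eq0 P.
  by rewrite lead_coefE sP -size_poly_eq0 sP => ->.
move=> /(quadratic_disc0_sqr_dvd _ _ _ _ a0)[z]; apply/negP.
have := sepP z; rewrite [P in map_poly _ P]quadratic_polyE ?sP //.
by rewrite !rmorphD /= !map_polyZ /= map_polyXn map_polyX map_polyC.
Qed.

Lemma abs_affine_bounds (a b : int) (n : nat) (y := absz (2 * a * n%:Z + b)) :
  (y <= 2 * `|a| * n + `|b|)%N /\ (2 * `|a| * n <= y + `|b|)%N.
Proof.
have: absz (2 * a * n%:Z) = (2 * `|a| * n)%N by rewrite !abszM.
by rewrite /y; lia.
Qed.

(** Values of opposite sign would give a (m + n) = -b, hence m + n <= |b|, against |b| < m. *)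
Lemma abs_affine_inj (a b : int) (m n : nat) : a != 0 -> (`|b| < m)%N ->
  absz (2 * a * m%:Z + b) = absz (2 * a * n%:Z + b) -> m = n.
Proof.
move=> a0 bm ymn.
have [e|e] : 2 * a * m%:Z = 2 * a * n%:Z \/ a * (m + n)%N%:Z = - b.
- by rewrite PoszD mulrDr -!mulrA in ymn *; lia.
- by move: e; rewrite -!mulrA => /(mulfI (isT : 2 != 0 :> int)) /(mulfI a0) [].
- have : (m + n <= `|b|)%N by rewrite -abszN -e abszM leq_pmull // absz_gt0.
  by lia.
Qed.

(** * Choice of parameters and passage from triples to pairs *)

Theorem proposition5p1 (R : realType) (P : {poly int}) :
  size P = 3%N ->
  separable_over_C R P ->
  exists C : R, 0 < C /\
    forall N : nat, (2 <= N)%N -> (M2 N P)%:R <= C * Num.sqrt (N%:R : R).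
Proof.
move=> sP sepP; have D0 := quadratic_disc_neq0 R P sP sepP.
have a0 : P`_2 != 0.
  by have := lead_coef_eq0 P; rewrite lead_coefE sP -size_poly_eq0 sP => ->.
have PE (n : nat) : P.[n%:Z] = P`_2 * n%:Z ^+ 2 + P`_1 * n%:Z + P`_0.
  by rewrite {1}[P]quadratic_polyE ?sP // !hornerE.
move: D0 a0 PE; set a := P`_2; set b := P`_1; set c := P`_0; set D := _ - _ => D0 a0 PE.
clearbody a b c.
(* Here y <= s N. The factor 256 in [B] absorbs N <= 256 r^6, and [B] exceeds |D|. For n >= [n0],
   2|a|n - |b| is at least [B] and n > |b| gives injectivity. *)
pose s := (2 * `|a| + `|b|)%N.
pose B := (256 * s + `|D|.+1)%N.
pose n0 := (B + `|b|.+1)%N.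
pose k := (24 * (3 * `|D|).+1)%N.
pose C := (2 * (n0 * (n0 + k)) + (3 * `|D|).+1 * (k * k) + 72 + 36 * (3 * `|D| * B).+1)%N.
exists C%:R; split; first by rewrite ltr0n /C !addn_gt0 !orbT.
move=> N N2.
have [H [H0 HN NH]] := nat_root_exists 2 N isT (ltnW N2).
have [r [r0 rH Hr]] := nat_root_exists 3 H isT H0.
suff M2_le : (M2 N P <= C * H)%N.
  apply: (@le_trans _ _ (C * H)%:R); first by rewrite ler_nat.
  rewrite natrM ler_wpM2l // -[H%:R]ger0_norm // -sqrtr_sqr ler_wsqrtr //.
  by rewrite -natrX ler_nat.
pose y (n : 'I_N.+1) := absz (2 * a * n%:Z + b)%R.
have yE n : (y n)%:Z ^+ 2 - D = 4 * a * P.[n%:Z].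
  by rewrite /y abszE real_normK ?num_real // PE /D; ring.
have a_gt0 : (0 < `|a|)%N by rewrite absz_gt0.
have y_le_sN n : (y n <= s * N)%N.
  apply: leq_trans (abs_affine_bounds a b n).1 _; rewrite /s mulnDl leq_add //.
    by rewrite leq_mul2l -ltnS ltn_ord orbT.
  by rewrite leq_pmulr // ltnW.
pose S0 := [set n : 'I_N.+1 | (n < n0)%N]%SET.
have S0P (n : 'I_N.+1) : n \notin S0 -> (n0 <= n)%N by rewrite inE -leqNgt.
have card_S0 : (#|S0| <= n0)%N.
  rewrite -[n0]muln1; apply: (card_cover _ _ (fun j (n : 'I_N.+1) => n = j :> nat)).
    by move=> n; rewrite inE => nn0; exists n.
  move=> j F _ Fj; apply/card_le1_eqP => m n /Fj mj /Fj nj.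
  by apply: val_inj; rewrite /= nj.
have y_inj : {in ~: S0 &, injective y}.
  move=> m n; rewrite !inE -!leqNgt => mn0 _ ymn.
  apply/val_inj/(abs_affine_inj _ _ _ _ a0 _ ymn).
  by rewrite (leq_trans _ mn0) // leq_addl.
have y_ge n : n \notin S0 -> (B <= y n)%N.
  move=> /S0P nn0; have [_] := abs_affine_bounds a b n.
  have : (n <= 2 * `|a| * n)%N by rewrite leq_pmull // muln_gt0.
  move=> n2an yn; rewrite -(leq_add2r `|b|) (leq_trans _ (leq_trans n2an yn)) //.
  by apply: leq_trans nn0; rewrite leq_add2l leqnSn.
have B_gt s' : (0 < s')%N -> (256 * s * s' < B * s')%N.
  by move=> ?; rewrite ltn_pmul2r // /B; lia.
(* As [H] and [r] are positive, N < (H+1)^2 <= 4 H^2 and H < (r+1)^3 <= 8 r^3; together N <= 4 * 8^2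
   * r^6. *)
have NH4 : (N <= 4 * H ^ 2)%N.
  by apply: ltnW (leq_trans NH _); rewrite -(expnMn 2 H 2) leq_exp2r //; lia.
have Hr8 : (H <= 8 * r ^ 3)%N.
  by apply: ltnW (leq_trans Hr _); rewrite -(expnMn 2 r 3) leq_exp2r //; lia.
have Nr : (N <= 256 * r ^ 6)%N.
  apply: (leq_trans NH4); rewrite -[256%N]/(4 * 64)%N -mulnA leq_mul2l /=.
  by rewrite -[64%N]/(8 ^ 2)%N (expnM r 3 2) -expnMn leq_exp2r.
have pairs_le := @card_sqrel_pairs 'I_N.+1 y D S0 B r H n0 D0.
apply: leq_trans (pairs_le _ _ _ _ _ _ _ _) => //; last first.
- move=> n _; apply: (leq_trans (y_le_sN n)).
  apply: (@leq_trans (s * (4 * H ^ 2))); first by rewrite leq_mul2l NH4 orbT.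
  by rewrite mulnA leq_mul2r /B; apply/orP; right; lia.
- move=> n _; apply: (leq_ltn_trans (y_le_sN n)).
  apply: leq_ltn_trans (B_gt _ _); last by rewrite expn_gt0 r0.
  by rewrite (mulnC 256%N) -mulnA leq_mul2l Nr orbT.
- by rewrite /B; lia.
rewrite /M2 cardE; set F := fset_set _; set S := finset _.
pose f (t : nat * nat * nat) : 'I_N.+1 * 'I_N.+1 := (inord t.1.2, inord t.2).
have FP t : t \in F -> square_triples N P t.
  by rewrite in_fset_set; [exact: set_mem|exact: finite_square_triples].
(* Dropping m loses nothing: a natural number is determined by its square. *)
have f_inj : {in F &, injective f}.
  move=> [[m1 n1] n2] [[m1' n1'] n2'] /FP[/andP[_ n1N] /andP[_ n2N] mE m0 _].
  move=> /FP[/andP[_ n1N'] /andP[_ n2N'] mE' _ _].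
  move=> [/(congr1 val) /= e1 /(congr1 val) /= e2].
  rewrite !inordK // in e1 e2; subst n1' n2'.
  by congr (_, _, _); move: mE'; rewrite mE => /eqP; rewrite eqrXn2 // => /eqP[].
rewrite -(size_map f) uniq_leq_size //; first by rewrite map_inj_in_uniq ?fset_uniq.
move=> p /mapP[[[m n1] n2] /FP[/andP[_ n1N] /andP[_ n2N] mE m0 n12] ->].
rewrite mem_enum inE /=; apply/andP; split.
  by apply/eqP => /(congr1 val) /=; rewrite !inordK.
apply/asboolP; rewrite !yE !inordK //.
(* Passing from P(n) to y^2 - D multiplies the product by the nonzero square (4a)^2. *)
have sqE : 4 * a * P.[n1%:Z] * (4 * a * P.[n2%:Z]) = (4 * a * m%:Z) ^+ 2.
  by rewrite exprMn -mE; ring.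
split; last by exists (4 * a * m%:Z).
by rewrite sqE sqrf_eq0 !mulf_neq0 //; rewrite sqrf_eq0 in m0.
Qed.
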